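(* For every real $s\ge -1$ with $s\neq 0$, the strict inequality $$\log \Phi(s+2) > R(s)$$ holds, where $$R(s)=\frac{1}{24}\,\frac{s^2}{\kappa(\kappa+s)(2\kappa+s)},\qquad \kappa=1+\frac{1}{\sqrt{12}}.$$ Moreover, $\Phi(2)=1$.
   Context: The function $\Phi:[1,\infty)\to\mathbb{R}$ is defined by $$\Phi(x)=2\left(1-\frac1x\right)^{x-1}\frac{\Gamma\left(\frac12+\frac x2\right)\Gamma(x)}{\Gamma\left(1+\frac x2\right)\Gamma\left(x-\frac12\right)}\quad\text{for }x>1,\qquad \Phi(1)=\frac4\pi,$$ where $\Gamma$ is Euler's Gamma function and $\log$ is the natural logarithm. *)

(* Defs.v *)
From Stdlib Require Import Reals.
From Coquelicot Require Import Coquelicot.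
Local Open Scope R_scope.

(* Meaningful for [x > 0], where the integral over (0, +oo) converges. *)
Definition Gamma (x : R) : R :=
  RInt_gen (fun t : R => Rpower t (x - 1) * exp (- t))
    (at_right 0) (Rbar_locally p_infty).

(* The domain is [1, +oo); values at [x < 1] are junk.  For [x > 1] all four
   arguments of [Gamma] are at least 1/2 and the base of the power is
   positive, as [Rpower] requires. *)
Definition Phi (x : R) : R :=
  if Req_EM_T x 1 then 4 / PI
  else
    2 * Rpower (1 - 1 / x) (x - 1) *
      ((Gamma (1 / 2 + x / 2) * Gamma x) /
       (Gamma (1 + x / 2) * Gamma (x - 1 / 2))).

Definition kappa : R := 1 + 1 / sqrt 12.

(* The denominator is positive for [s >= -1], since [kappa > 1]. *)
Definition Rbound (s : R) : R :=
  1 / 24 * (s ^ 2 / (kappa * (kappa + s) * (2 * kappa + s))).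

(* Main.v *)
Require Import Defs.
From Stdlib Require Import Reals Lra Lia.
From Coquelicot Require Import Coquelicot.
Local Open Scope R_scope.

(* Put rho y = ln (Gamma (y + 1/2) / Gamma y).  Then
     ln (Phi x) = ln 2 + (x - 1) ln (1 - 1/x) + rho (x - 1/2) - rho ((x + 1) / 2),
   and rho y - rho (y + 1) = ln (y / (y + 1/2)) is elementary.  The errors of the
   approximation from below ln (y - 1/4) / 2 and of the approximation from above
   ln (y - 1/4) / 2 + 1 / (64 (y - 1/4)^2) of rho tend to 0 (by log-convexity of Gamma),
   hence are sums of elementary terms over y, y + 1, y + 2, ...; as these terms are
   decreasing and convex, so are both errors.
   Let x = s + 2 and compare ln (Phi x) with R(s), after lowering kappa to 5/4.  The
   difference has a double zero at x = 2.  On (1, 7/3], replace the two errors by their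
   tangents at x = 2 (the slopes are known since psi 3 - psi (5/2) = 2 ln 2 - 7/6); what
   remains is elementary with positive second derivative and keeps the double zero.
   On [7/3, +oo), exchange the roles of the two approximations: the errors then
   contribute an increasing function, and so does the elementary rest. *)

(** * The Gamma function *)

(** Enlarging the interval increases the integral of a nonnegative function, so the supremum [l] of
    the integrals over compact intervals is also their limit. *)
Lemma is_RInt_gen_nonneg_bounded (f : R -> R) (M : R) :
  (forall t, 0 < t -> continuous f t) ->
  (forall t, 0 < t -> 0 <= f t) ->
  (forall a b, 0 < a <= b -> RInt f a b <= M) ->
  exists l, is_RInt_gen f (at_right 0) (Rbar_locally p_infty) l /\
    forall a b, 0 < a <= b -> RInt f a b <= l.
Proof.
intros Hc Hpos HM.
assert (Hex : forall a b, 0 < a -> 0 < b -> ex_RInt f a b).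
{ intros a b Ha Hb. apply (ex_RInt_continuous (V := R_CompleteNormedModule)). intros z Hz. apply Hc.
  apply Rlt_le_trans with (2 := proj1 Hz). now apply Rmin_glb_lt. }
set (E := fun v => exists a b, 0 < a <= b /\ v = RInt f a b).
destruct (completeness E) as [l [Hub Hlub]].
{ exists M. intros v (a & b & Hab & ->). now apply HM. }
{ exists (RInt f 1 1), 1, 1. split; [lra | easy]. }
assert (Hle : forall a b, 0 < a <= b -> RInt f a b <= l).
{ intros a b Hab. apply Hub. now exists a, b. }
exists l. split; [| exact Hle].
assert (Hmono : forall a b a0 b0, 0 < a <= a0 -> a0 <= b0 <= b ->
  RInt f a0 b0 <= RInt f a b).
{ intros a b a0 b0 Ha Hb.
  rewrite <- (RInt_Chasles f a a0 b) by (apply Hex; lra).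
  rewrite <- (RInt_Chasles f a0 b0 b) by (apply Hex; lra).
  assert (0 <= RInt f a a0).
  { apply RInt_ge_0; try lra. apply Hex; lra. intros t Ht; apply Hpos; lra. }
  assert (0 <= RInt f b0 b).
  { apply RInt_ge_0; try lra. apply Hex; lra. intros t Ht; apply Hpos; lra. }
  unfold plus; simpl. lra. }
intros P [eps HP].
assert (Hnear : exists a0 b0, 0 < a0 <= b0 /\ l - eps < RInt f a0 b0).
{ destruct (Classical_Prop.classic
    (exists a0 b0, 0 < a0 <= b0 /\ l - eps < RInt f a0 b0)) as [H | H]; [easy |].
  exfalso. assert (l <= l - eps); [| destruct eps; simpl in *; lra].
  apply Hlub. intros v (a & b & Hab & ->).
  apply Rnot_lt_le. intros Hlt. apply H. now exists a, b. }
destruct Hnear as (a0 & b0 & Hab & Hlt).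
apply Filter_prod with (Q := fun a => 0 < a < a0) (R := fun b => b0 < b).
- exists (mkposreal a0 (proj1 Hab)). intros y Hy Hy0. split; [easy |].
  change (Rabs (y - 0) < a0) in Hy. apply Rabs_def2 in Hy. lra.
- now exists b0.
- intros a b Ha Hb. exists (RInt f a b). split.
  + apply (RInt_correct (V := R_CompleteNormedModule)), Hex; simpl; lra.
  + apply HP. change (Rabs (RInt f a b - l) < eps).
    assert (RInt f a b <= l) by (apply Hle; lra).
    assert (RInt f a0 b0 <= RInt f a b) by (apply Hmono; lra).
    apply Rabs_def1; lra.
Qed.

Lemma exp_le_compat (x y : R) : x <= y -> exp x <= exp y.
Proof.
intros [H | ->]; [now apply Rlt_le, exp_increasing | apply Rle_refl].
Qed.

Lemma ln_le_sub_one (u : R) : 0 < u -> ln u <= u - 1.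
Proof.
intros Hu. rewrite <- (ln_exp (u - 1)). apply ln_le; [easy |].
pose proof (exp_ineq1_le (u - 1)). lra.
Qed.

(** The maximum is at [t = p]; the bound is [ln u <= u - 1] at [u = t / p]. *)
Lemma Rpower_exp_bounded (p t : R) :
  0 < p -> 0 < t -> Rpower t p * exp (- t) <= exp (p * (ln p - 1)).
Proof.
intros Hp Ht. unfold Rpower. rewrite <- exp_plus.
apply exp_le_compat.
pose proof (ln_le_sub_one (t / p) (Rdiv_lt_0_compat _ _ Ht Hp)) as H.
rewrite ln_div in H by easy.
replace (- t) with (- (p * (t / p))) by (field; lra).
nra.
Qed.

Definition gamma_integrand (x t : R) : R := Rpower t (x - 1) * exp (- t).

Lemma gamma_integrand_continuous (x t : R) :
  0 < t -> continuous (gamma_integrand x) t.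
Proof.
intros Ht. apply (ex_derive_continuous (gamma_integrand x)).
unfold gamma_integrand, Rpower. auto_derive. easy.
Qed.

Lemma gamma_integrand_pos (x t : R) : 0 < gamma_integrand x t.
Proof. apply Rmult_lt_0_compat; apply exp_pos. Qed.

(* [- 1 / (1 + t^x)] is bounded, and a multiple of its derivative dominates the integrand. *)
Lemma gamma_integrand_bounded (x : R) : 0 < x ->
  exists M, forall a b, 0 < a <= b -> RInt (gamma_integrand x) a b <= M.
Proof.
intros Hx.
(* Chosen so that [exp (- t) * (1 + t^x)^2 <= C * x]: the square is at most [2 + 2 * t^(2x)], and
   [Rpower_exp_bounded] with [p = 2 * x] controls [t^(2x) * exp (- t)]. *)
set (C := (2 + 2 * exp (2 * x * (ln (2 * x) - 1))) / x).
assert (HC : 0 < C).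
{ apply Rdiv_lt_0_compat; [| easy].
  pose proof (exp_pos (2 * x * (ln (2 * x) - 1))). lra. }
set (H := fun t => - C / (1 + Rpower t x)).
set (h := fun t => C * x * Rpower t (x - 1) / (1 + Rpower t x) ^ 2).
assert (HP : forall t, 0 < Rpower t x) by (intros; apply exp_pos).
assert (HH : forall t, 0 < t -> is_derive H t (h t)).
{ intros t Ht. unfold H, h.
  replace (x - 1) with (x + - (1)) by ring.
  rewrite (Rpower_plus x (- (1)) t), (Rpower_Ropp t 1), Rpower_1 by easy.
  specialize (HP t). unfold Rpower in *. auto_derive.
  - split; [easy |]. lra.
  - field. lra. }
assert (Hh : forall t, 0 < t -> continuous h t).
{ intros t Ht. apply (ex_derive_continuous h). unfold h.
  specialize (HP t). unfold Rpower in *. auto_derive.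
  repeat split; try easy; nra. }
exists C. intros a b Hab.
assert (HI : is_RInt h a b (H b - H a)).
{ apply (is_RInt_derive H h).
  - intros t Ht. apply HH. rewrite Rmin_left in Ht; lra.
  - intros t Ht. apply Hh. rewrite Rmin_left in Ht; lra. }
apply Rle_trans with (H b - H a).
- rewrite <- (is_RInt_unique _ _ _ _ HI).
  apply RInt_le; try lra.
  + apply (ex_RInt_continuous (V := R_CompleteNormedModule)).
    intros t Ht. apply gamma_integrand_continuous.
    rewrite Rmin_left in Ht; lra.
  + now exists (H b - H a).
  + intros t Ht. unfold gamma_integrand, h.
    pose proof (Rpower_exp_bounded (2 * x) t ltac:(lra) ltac:(lra)) as Hb.
    replace (2 * x) with (x + x) in Hb at 1 by ring.
    rewrite Rpower_plus in Hb.
    specialize (HP t). set (w := Rpower t x) in *.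
    assert (He : exp (- t) * (1 + w) ^ 2 <= C * x).
    { unfold C. replace (_ / x * x) with (2 + 2 * exp (2 * x * (ln (2 * x) - 1)))
        by (field; lra).
      assert (exp (- t) <= 1) by (rewrite <- exp_0; apply exp_le_compat; lra).
      pose proof (exp_pos (- t)).
      assert ((1 + w) ^ 2 <= 2 + 2 * (w * w)) by (pose proof (pow2_ge_0 (1 - w)); lra).
            apply Rle_trans with (exp (- t) * (2 + 2 * (w * w))); [| lra].
      apply Rmult_le_compat_l; lra. }
    apply Rmult_le_reg_r with ((1 + w) ^ 2); [apply pow_lt; lra |].
    replace (C * x * Rpower t (x - 1) / (1 + w) ^ 2 * (1 + w) ^ 2)
      with (Rpower t (x - 1) * (C * x)) by (field; lra).
    rewrite Rmult_assoc. apply Rmult_le_compat_l; [apply Rlt_le, exp_pos | easy].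
- unfold H. pose proof (HP a). pose proof (HP b).
  assert (0 < C / (1 + Rpower b x)) by (apply Rdiv_lt_0_compat; lra).
  assert (C / (1 + Rpower a x) <= C).
  { apply Rmult_le_reg_r with (1 + Rpower a x); [lra |].
    replace (C / (1 + Rpower a x) * (1 + Rpower a x)) with C by (field; lra). nra. }
  unfold Rdiv in *. lra.
Qed.

(** [RInt_gen] is a total function, so [Gamma x] is known to be the integral only once convergence
    is established. *)
Lemma Gamma_spec (x : R) : 0 < x ->
  is_RInt_gen (gamma_integrand x) (at_right 0) (Rbar_locally p_infty) (Gamma x) /\
  forall a b, 0 < a <= b -> RInt (gamma_integrand x) a b <= Gamma x.
Proof.
intros Hx. destruct (gamma_integrand_bounded x Hx) as [M HM].
destruct (is_RInt_gen_nonneg_bounded (gamma_integrand x) M) as [l [Hl Hle]]; try easy.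
- intros t Ht. now apply gamma_integrand_continuous.
- intros t _. apply Rlt_le, gamma_integrand_pos.
- replace (Gamma x) with l; [now split |].
  symmetry. exact (is_RInt_gen_unique (V := R_CompleteNormedModule) _ _ Hl).
Qed.

Lemma Gamma_correct (x : R) : 0 < x ->
  is_RInt_gen (gamma_integrand x) (at_right 0) (Rbar_locally p_infty) (Gamma x).
Proof. intros Hx. apply (Gamma_spec x Hx). Qed.

Lemma Gamma_pos (x : R) : 0 < x -> 0 < Gamma x.
Proof.
intros Hx.
apply Rlt_le_trans with (RInt (gamma_integrand x) 1 2).
- apply RInt_gt_0; try lra.
  + intros t _. apply gamma_integrand_pos.
  + intros t Ht. apply gamma_integrand_continuous. lra.
- apply (Gamma_spec x Hx). lra.
Qed.

Lemma filter_prod_positive (P : R -> Prop) : (forall t, 0 < t -> P t) ->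
  filter_prod (at_right 0) (Rbar_locally p_infty)
    (fun ab => forall t, Rmin (fst ab) (snd ab) <= t <= Rmax (fst ab) (snd ab) -> P t).
Proof.
intros HP. apply Filter_prod with (Q := fun a => 0 < a) (R := fun b => 0 < b).
- exists (mkposreal 1 Rlt_0_1). now intros.
- now exists 0.
- intros a b Ha Hb t Ht. apply HP. apply Rlt_le_trans with (2 := proj1 Ht).
  now apply Rmin_glb_lt.
Qed.

Lemma is_RInt_gen_ext_pos (f g : R -> R) (l : R) : (forall t, 0 < t -> f t = g t) ->
  is_RInt_gen f (at_right 0) (Rbar_locally p_infty) l ->
  is_RInt_gen g (at_right 0) (Rbar_locally p_infty) l.
Proof.
intros Hfg. apply is_RInt_gen_ext.
apply (filter_imp _ _ (fun ab H t Ht =>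
  H t (conj (Rlt_le _ _ (proj1 Ht)) (Rlt_le _ _ (proj2 Ht))))).
now apply filter_prod_positive.
Qed.

Lemma Rpower_exp_lim_0 (x : R) : 0 < x ->
  filterlim (fun t => Rpower t x * exp (- t)) (at_right 0) (locally 0).
Proof.
intros Hx P [eps HP].
exists (mkposreal (Rpower eps (/ x)) (exp_pos _)). intros t Ht Ht0.
change (Rabs (t - 0) < Rpower eps (/ x)) in Ht. apply Rabs_def2 in Ht.
apply HP. change (Rabs (Rpower t x * exp (- t) - 0) < eps).
pose proof (exp_pos (- t)). pose proof (exp_pos (x * ln t)) as Hp.
change (0 < Rpower t x) in Hp.
assert (exp (- t) <= 1) by (rewrite <- exp_0; apply exp_le_compat; lra).
assert (Rpower t x < eps).
{ replace (pos eps) with (Rpower (Rpower eps (/ x)) x).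
  - apply Rlt_Rpower_l; lra.
  - rewrite Rpower_mult. replace (/ x * x) with 1 by (field; lra).
    apply Rpower_1. apply cond_pos. }
apply Rabs_def1; nra.
Qed.

Lemma Rpower_exp_lim_infty (x : R) : 0 < x ->
  filterlim (fun t => Rpower t x * exp (- t)) (Rbar_locally p_infty) (locally 0).
Proof.
intros Hx P [eps HP].
(* One spare power of [t]: from [t^(x+1) * exp (- t) <= C] follows [t^x * exp (- t) <= C / t]. *)
set (C := exp ((x + 1) * (ln (x + 1) - 1))).
exists (C / eps). intros t Ht.
assert (HC : 0 < C) by apply exp_pos. pose proof (cond_pos eps) as He.
assert (Ht0 : 0 < t).
{ apply Rlt_trans with (2 := Ht). now apply Rdiv_lt_0_compat. }
pose proof (Rpower_exp_bounded (x + 1) t ltac:(lra) Ht0) as Hb.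
fold C in Hb. rewrite Rpower_plus, Rpower_1 in Hb by easy.
apply HP. change (Rabs (Rpower t x * exp (- t) - 0) < eps).
pose proof (Rmult_lt_0_compat _ _ (exp_pos (x * ln t)) (exp_pos (- t))) as Hp.
change (0 < Rpower t x * exp (- t)) in Hp.
assert (C < t * eps).
{ apply (Rmult_lt_compat_r eps) in Ht; [| easy].
  replace (C / eps * eps) with C in Ht by (field; lra). lra. }
apply Rabs_def1; nra.
Qed.

(** Integration by parts: [F t = t^x * exp (- t)] vanishes at both ends, so its derivative
    integrates to 0. *)
Lemma Gamma_succ (x : R) : 0 < x -> Gamma (x + 1) = x * Gamma x.
Proof.
intros Hx.
pose (F := fun t => Rpower t x * exp (- t)).
assert (HF : forall t, 0 < t ->
  is_derive F t (x * gamma_integrand x t - gamma_integrand (x + 1) t)).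
{ intros t Ht. unfold F, gamma_integrand.
  replace (x + 1 - 1) with x by ring.
  replace (x - 1) with (x + - (1)) by ring.
  rewrite (Rpower_plus x (- (1)) t).
  rewrite (Rpower_Ropp t 1), Rpower_1 by easy.
  unfold Rpower. auto_derive; [easy |]. field. lra. }
assert (H0 : is_RInt_gen (Derive F) (at_right 0) (Rbar_locally p_infty) (0 - 0)).
{ apply is_RInt_gen_Derive.
  - apply filter_prod_positive. intros t Ht. eexists. now apply HF.
  - apply filter_prod_positive. intros t Ht.
    apply continuous_ext_loc with
      (fun t => x * gamma_integrand x t - gamma_integrand (x + 1) t).
    + exists (mkposreal t Ht). intros y Hy. symmetry. apply is_derive_unique, HF.
      change (Rabs (y - t) < t) in Hy. apply Rabs_def2 in Hy. lra.
    + apply (ex_derive_continuous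
        (fun t => x * gamma_integrand x t - gamma_integrand (x + 1) t)).
      unfold gamma_integrand, Rpower. now auto_derive.
  - now apply Rpower_exp_lim_0.
  - now apply Rpower_exp_lim_infty. }
pose proof (is_RInt_gen_minus _ _ _ _
  (is_RInt_gen_scal _ x _ (Gamma_correct x Hx))
  (Gamma_correct (x + 1) ltac:(lra))) as H1.
apply (is_RInt_gen_ext_pos _ (Derive F)) in H1.
- pose proof (is_RInt_gen_unique (V := R_CompleteNormedModule) _ _ H0) as E0.
  rewrite (is_RInt_gen_unique (V := R_CompleteNormedModule) _ _ H1) in E0.
  unfold minus, plus, opp, scal in E0; simpl in E0; unfold mult in E0; simpl in E0.
  lra.
- intros t Ht. symmetry. now apply is_derive_unique, HF.
Qed.

(* Cauchy-Schwarz, from the nonnegativity of the integral of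
   [t^(y-1) e^(-t) (sqrt t - lambda)^2] with the optimal [lambda]. *)
Lemma Gamma_half_sqr_le (y : R) : 0 < y ->
  Gamma (y + 1 / 2) ^ 2 <= Gamma y * Gamma (y + 1).
Proof.
intros Hy.
pose proof (Gamma_pos y Hy) as Hp.
set (lam := Gamma (y + 1 / 2) / Gamma y).
assert (H1 : is_RInt_gen (fun t => gamma_integrand y t * (Rpower t (1 / 2) - lam) ^ 2)
  (at_right 0) (Rbar_locally p_infty)
  (Gamma (y + 1) + (- 2 * lam * Gamma (y + 1 / 2) + lam ^ 2 * Gamma y))).
{ apply (is_RInt_gen_ext_pos (fun t => plus (gamma_integrand (y + 1) t)
    (plus (scal (- 2 * lam) (gamma_integrand (y + 1 / 2) t))
      (scal (lam ^ 2) (gamma_integrand y t))))).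
  - intros t Ht. unfold gamma_integrand, plus, scal; simpl; unfold mult; simpl.
    replace (y + 1 - 1) with (y - 1 + 1 / 2 + 1 / 2) by field.
    replace (y + 1 / 2 - 1) with (y - 1 + 1 / 2) by field.
    rewrite !Rpower_plus. ring.
  - apply (is_RInt_gen_plus (V := R_NormedModule)); [apply Gamma_correct; lra |].
    apply (is_RInt_gen_plus (V := R_NormedModule));
      apply (is_RInt_gen_scal (V := R_NormedModule)); apply Gamma_correct; lra. }
(* Comparing the zero function with the integrand of [H1] through [RInt_gen_norm] yields that the
   integral in [H1] is nonnegative. *)
assert (H2 : is_RInt_gen (fun _ : R => 0) (at_right 0) (Rbar_locally p_infty)
  (scal 0 (Gamma y))).
{ apply (is_RInt_gen_ext_pos (fun t => scal 0 (gamma_integrand y t))).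
  - intros t _. apply Rmult_0_l.
  - apply (is_RInt_gen_scal (V := R_NormedModule)). now apply Gamma_correct. }
assert (H3 := fun Hle Hnorm =>
  RInt_gen_norm (V := R_CompleteNormedModule) _ _ _ _ Hle Hnorm H2 H1).
match type of H3 with _ -> _ -> ?A <= _ => assert (H4 : 0 <= A) by apply norm_ge_0 end.
unfold plus, scal in H3; simpl in H3; unfold mult in H3; simpl in H3.
match type of H3 with _ -> _ -> _ <= ?B => assert (H5 : 0 <= B) end.
{ apply Rle_trans with (1 := H4), H3.
- apply Filter_prod with (Q := fun a => 0 < a < 1) (R := fun b => 1 < b).
  + exists (mkposreal 1 Rlt_0_1). intros a Ha Ha0. split; [easy |].
    change (Rabs (a - 0) < 1) in Ha. apply Rabs_def2 in Ha. lra.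
  + now exists 1.
  + intros a b Ha Hb. simpl. lra.
- apply filter_forall. intros ab t _.
  change (norm (0:R)) with (Rabs 0). rewrite Rabs_R0.
  apply Rmult_le_pos; [apply Rlt_le, gamma_integrand_pos | apply pow2_ge_0]. }
clear H3 H4. unfold lam in H5.
replace (Gamma (y + 1) + _) with (Gamma (y + 1) - Gamma (y + 1 / 2) ^ 2 / Gamma y) in H5
  by (field; lra).
apply Rmult_le_reg_r with (/ Gamma y); [now apply Rinv_0_lt_compat |].
replace (Gamma y * Gamma (y + 1) * / Gamma y) with (Gamma (y + 1)) by (field; lra).
unfold Rdiv in H5. lra.
Qed.

(** * Bounds for ln (Gamma (y + 1/2) / Gamma y) *)

Definition log_ratio (y : R) : R := ln (Gamma (y + 1 / 2)) - ln (Gamma y).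

Lemma log_ratio_succ (y : R) : 0 < y ->
  log_ratio y = ln y - ln (y + 1 / 2) + log_ratio (y + 1).
Proof.
intros Hy. unfold log_ratio.
replace (y + 1 + 1 / 2) with (y + 1 / 2 + 1) by ring.
pose proof (Gamma_pos y Hy). pose proof (Gamma_pos (y + 1 / 2) ltac:(lra)).
rewrite !Gamma_succ, !ln_mult by lra. ring.
Qed.

(** With [Gamma (y + 1) = y * Gamma y], the Cauchy-Schwarz bound reads
    [Gamma (y + 1/2)^2 <= y * Gamma y ^ 2]. *)
Lemma log_ratio_upper (y : R) : 0 < y -> log_ratio y <= ln y / 2.
Proof.
intros Hy. unfold log_ratio.
pose proof (Gamma_half_sqr_le y Hy) as H.
pose proof (Gamma_pos y Hy). pose proof (Gamma_pos (y + 1 / 2) ltac:(lra)).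
rewrite Gamma_succ in H by easy.
apply ln_le in H; [| now apply pow_lt].
simpl in H. rewrite Rmult_1_r, !ln_mult in H by (try apply Rmult_lt_0_compat; lra). lra.
Qed.

(** The same Cauchy-Schwarz bound, taken at [y - 1/2], has [Gamma y] on its small side. *)
Lemma log_ratio_lower (y : R) : 1 / 2 < y -> ln (y - 1 / 2) / 2 <= log_ratio y.
Proof.
intros Hy. unfold log_ratio.
pose proof (Gamma_half_sqr_le (y - 1 / 2) ltac:(lra)) as H.
pose proof (Gamma_succ (y - 1 / 2) ltac:(lra)) as Hs.
replace (y - 1 / 2 + 1) with (y + 1 / 2) in * by field.
replace (y - 1 / 2 + 1 / 2) with y in * by field.
pose proof (Gamma_pos y ltac:(lra)). pose proof (Gamma_pos (y - 1 / 2) ltac:(lra)).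
pose proof (Gamma_pos (y + 1 / 2) ltac:(lra)).
apply ln_le in H; [| now apply pow_lt].
simpl in H. rewrite Rmult_1_r, !ln_mult in H by lra.
rewrite Hs, ln_mult in * by lra. lra.
Qed.

(* The leading term of the Stirling expansion of [log_ratio] in [y - 1/4]; that shift
   removes the [1/y] term, and the next term is [1 / (64 (y - 1/4)^2)]. *)
Definition log_ratio_approx (y : R) : R := ln (y - 1 / 4) / 2.

(** A crude rate that makes the error vanish at infinity: [ln y / 2] and [ln (y - 1/2) / 2] enclose
    both [log_ratio y] and its approximation. *)
Lemma log_ratio_approx_error (y : R) : 1 < y ->
  Rabs (log_ratio y - log_ratio_approx y) <= / (y - 1).
Proof.
intros Hy. unfold log_ratio_approx.
pose proof (log_ratio_upper y ltac:(lra)). pose proof (log_ratio_lower y ltac:(lra)).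
pose proof (ln_le_sub_one (y / (y - 1 / 4)) ltac:(apply Rdiv_lt_0_compat; lra)) as H1.
pose proof (ln_le_sub_one ((y - 1 / 4) / (y - 1 / 2)) ltac:(apply Rdiv_lt_0_compat; lra)) as H2.
rewrite ln_div in H1, H2 by lra.
replace (y / (y - 1 / 4) - 1) with (/ (y - 1 / 4) / 4) in H1 by (field; lra).
replace ((y - 1 / 4) / (y - 1 / 2) - 1) with (/ (y - 1 / 2) / 4) in H2 by (field; lra).
assert (0 < / (y - 1 / 4)) by (apply Rinv_0_lt_compat; lra).
assert (0 < / (y - 1 / 2)) by (apply Rinv_0_lt_compat; lra).
assert (/ (y - 1 / 4) <= / (y - 1)) by (apply Rinv_le_contravar; lra).
assert (/ (y - 1 / 2) <= / (y - 1)) by (apply Rinv_le_contravar; lra).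
apply Rabs_le. lra.
Qed.

Lemma is_lim_seq_inv_shift (c : R) : is_lim_seq (fun n => / (INR n + c)) 0.
Proof.
apply (is_lim_seq_inv _ p_infty); [| easy].
apply is_lim_seq_plus with p_infty c; [apply is_lim_seq_INR | apply is_lim_seq_const | easy].
Qed.

Lemma log_ratio_approx_lim (y : R) : 1 < y ->
  is_lim_seq (fun n => log_ratio (y + INR n) - log_ratio_approx (y + INR n)) 0.
Proof.
intros Hy. apply is_lim_seq_abs_0.
apply is_lim_seq_le_le with (fun _ => 0) (fun n => / (INR n + (y - 1))).
- intros n. split; [apply Rabs_pos |].
  pose proof (pos_INR n).
  replace (INR n + (y - 1)) with (y + INR n - 1) by ring.
  apply log_ratio_approx_error. lra.
- apply is_lim_seq_const.
- apply is_lim_seq_inv_shift.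
Qed.

(** * Functions given by telescoping series, and the value of a digamma difference *)

Lemma telescope (f delta : R -> R) (c y : R) (n : nat) :
  (forall u, c <= u -> f u - f (u + 1) = delta u) -> c <= y ->
  f y = sum_f_R0 (fun k => delta (y + INR k)) n + f (y + INR (S n)).
Proof.
intros Hf Hy. induction n as [| n IH].
- simpl. rewrite Rplus_0_r, <- Hf by easy. ring.
- rewrite IH, tech5. pose proof (pos_INR (S n)).
  rewrite <- (Hf (y + INR (S n))), (S_INR (S n)), <- Rplus_assoc by lra. ring.
Qed.

(** As [f] tends to 0 along [y + n], it is the sum of the [delta (y + k)]. Each term is convex,
    hence above its tangent at [y0 + k]; summing the tangents gives slope [D]. *)
Lemma telescope_tangent (f delta d : R -> R) (c y0 y D : R) :
  (forall u, c <= u -> f u - f (u + 1) = delta u) ->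
  (forall u, c <= u -> is_derive delta u (d u)) ->
  (forall u, c <= u -> is_lim_seq (fun n => f (u + INR n)) 0) ->
  (forall u v, c <= u <= v -> d u <= d v) ->
  is_lim_seq (fun n => sum_f_R0 (fun k => d (y0 + INR k)) n) D ->
  c <= y0 -> c <= y -> f y0 + D * (y - y0) <= f y.
Proof.
intros Hf Hdelta Hlim Hd HD Hy0 Hy.
assert (Htan : forall u v, c <= u -> c <= v -> delta u + d u * (v - u) <= delta v).
{ intros u v Hu Hv. destruct (Rtotal_order u v) as [H | [<- | H]].
  - destruct (MVT_cor2 delta d u v H) as (w & Hw & Hw').
    { intros w Hw. apply is_derive_Reals, Hdelta. lra. }
    pose proof (Hd u w ltac:(lra)). nra.
  - lra.
  - destruct (MVT_cor2 delta d v u H) as (w & Hw & Hw').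
    { intros w Hw. apply is_derive_Reals, Hdelta. lra. }
    pose proof (Hd w u ltac:(lra)). nra. }
assert (Hn : forall n, f y0 + sum_f_R0 (fun k => d (y0 + INR k)) n * (y - y0)
  <= f y + f (y0 + INR (S n)) - f (y + INR (S n))).
{ intros n. rewrite (telescope f delta c y n Hf Hy), (telescope f delta c y0 n Hf Hy0).
  assert (sum_f_R0 (fun k => delta (y0 + INR k)) n +
    sum_f_R0 (fun k => d (y0 + INR k)) n * (y - y0)
    <= sum_f_R0 (fun k => delta (y + INR k)) n); [| lra].
  rewrite Rmult_comm, scal_sum, <- plus_sum. apply sum_Rle. intros k _.
  pose proof (pos_INR k).
  pose proof (Htan (y0 + INR k) (y + INR k) ltac:(lra) ltac:(lra)). nra. }
assert (H : Rbar_le (f y0 + D * (y - y0)) (f y + 0 - 0)).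
{ apply (is_lim_seq_le _ _ _ _ Hn).
  - apply is_lim_seq_plus'; [apply is_lim_seq_const |].
    now apply (is_lim_seq_mult' _ _ D); [| apply is_lim_seq_const].
  - apply is_lim_seq_minus'.
    + apply is_lim_seq_plus'; [apply is_lim_seq_const |].
      apply (is_lim_seq_incr_1 (fun n => f (y0 + INR n))). now apply Hlim.
    + apply (is_lim_seq_incr_1 (fun n => f (y + INR n))). now apply Hlim. }
simpl in H. lra.
Qed.

(** The same series representation of [f], now with every term decreasing. *)
Lemma telescope_decreasing (f delta d : R -> R) (c y z : R) :
  (forall u, c <= u -> f u - f (u + 1) = delta u) ->
  (forall u, c <= u -> is_derive delta u (d u)) ->
  (forall u, c <= u -> is_lim_seq (fun n => f (u + INR n)) 0) ->
  (forall u, c <= u -> d u <= 0) ->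
  c <= y <= z -> f z <= f y.
Proof.
intros Hf Hdelta Hlim Hd Hyz.
assert (Hdec : forall u v, c <= u <= v -> delta v <= delta u).
{ intros u v [Hu [Huv | <-]]; [| lra].
  destruct (MVT_cor2 delta d u v Huv) as (w & Hw & Hw').
  { intros w Hw. apply is_derive_Reals, Hdelta. lra. }
  pose proof (Hd w ltac:(lra)). nra. }
assert (Hn : forall n, f z - f (z + INR (S n)) <= f y - f (y + INR (S n))).
{ intros n. rewrite (telescope f delta c y n Hf), (telescope f delta c z n Hf) by lra.
  assert (sum_f_R0 (fun k => delta (z + INR k)) n
    <= sum_f_R0 (fun k => delta (y + INR k)) n); [| lra].
  apply sum_Rle. intros k _. pose proof (pos_INR k). apply Hdec. lra. }
assert (H : Rbar_le (f z - 0) (f y - 0)).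
{ apply (is_lim_seq_le _ _ _ _ Hn).
  - apply is_lim_seq_minus'; [apply is_lim_seq_const |].
    apply (is_lim_seq_incr_1 (fun n => f (z + INR n))). apply Hlim. lra.
  - apply is_lim_seq_minus'; [apply is_lim_seq_const |].
    apply (is_lim_seq_incr_1 (fun n => f (y + INR n))). apply Hlim. lra. }
simpl in H. lra.
Qed.

(* [sum_f_R0] has [n + 1] terms, so this is the harmonic number [H_(n+1)]. *)
Definition harmonic (n : nat) : R := sum_f_R0 (fun k => / INR (S k)) n.

(** Converges to Euler's constant, which cancels in the application: only the existence of the limit
    matters. *)
Definition euler_seq (n : nat) : R := harmonic n - ln (INR (S n)).

Lemma ln_succ_sub_le (x : R) : 0 < x -> / (x + 1) <= ln (x + 1) - ln x <= / x.
Proof.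
intros Hx.
pose proof (ln_le_sub_one ((x + 1) / x) ltac:(apply Rdiv_lt_0_compat; lra)) as H1.
pose proof (ln_le_sub_one (x / (x + 1)) ltac:(apply Rdiv_lt_0_compat; lra)) as H2.
rewrite ln_div in H1, H2 by lra.
replace ((x + 1) / x - 1) with (/ x) in H1 by (field; lra).
replace (x / (x + 1) - 1) with (- / (x + 1)) in H2 by (field; lra).
lra.
Qed.

Lemma euler_seq_decreasing (n : nat) : euler_seq (S n) <= euler_seq n.
Proof.
unfold euler_seq, harmonic. rewrite tech5, (S_INR (S n)).
pose proof (ln_succ_sub_le (INR (S n)) (lt_0_INR _ (Nat.lt_0_succ n))). lra.
Qed.

Lemma euler_seq_pos (n : nat) : 0 <= euler_seq n.
Proof.
assert (H : ln (INR (S n) + 1) <= harmonic n).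
{ induction n as [| n IH]; unfold harmonic in *.
  - simpl. pose proof (ln_succ_sub_le 1 Rlt_0_1) as H. rewrite ln_1 in H. lra.
  - rewrite tech5, (S_INR (S n)) at 1.
    pose proof (ln_succ_sub_le (INR (S n) + 1)
      ltac:(pose proof (pos_INR (S n)); lra)) as H.
    rewrite <- (S_INR (S n)) in *. lra. }
unfold euler_seq.
pose proof (ln_le (INR (S n)) (INR (S n) + 1) (lt_0_INR _ (Nat.lt_0_succ n)) ltac:(lra)).
lra.
Qed.

(* Tends to [psi 3 - psi (5/2)], the slope of [log_ratio] at [5/2]. *)
Definition digamma_half_sum (n : nat) : R :=
  sum_f_R0 (fun k => / (5 / 2 + INR k) - / (3 + INR k)) n.

(** The sum is twice [1/5 - 1/6 + 1/7 - ...], a piece of the alternating harmonic series, whose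
    partial sum up to [2 m] is [H_(2m) - H_m]; here [m = n + 3]. The missing start
    [1 - 1/2 + 1/3 - 1/4], doubled, is [7/6]. *)
Lemma digamma_half_sum_harmonic (n : nat) :
  digamma_half_sum n = 2 * (harmonic (2 * n + 5) - harmonic (n + 2)) - 7 / 6.
Proof.
unfold digamma_half_sum, harmonic. induction n as [| n IH].
- simpl. field.
- rewrite tech5, IH.
  replace (2 * S n + 5)%nat with (S (S (2 * n + 5))) by lia.
  replace (S n + 2)%nat with (S (n + 2)) by lia.
  rewrite !tech5, !S_INR, !plus_INR, !mult_INR. pose proof (pos_INR n). simpl.
  field. lra.
Qed.

Lemma digamma_half_sum_lim : is_lim_seq digamma_half_sum (2 * ln 2 - 7 / 6).
Proof.
destruct (ex_finite_lim_seq_decr euler_seq 0 euler_seq_decreasing euler_seq_pos)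
  as [l Hl].
apply is_lim_seq_ext with
  (fun n => 2 * (euler_seq (2 * n + 5) - euler_seq (n + 2) + ln 2) - 7 / 6).
- intros n. rewrite digamma_half_sum_harmonic. unfold euler_seq.
  (* The two logarithms inside [euler_seq] have arguments in ratio exactly 2, whence [ln 2]. *)
  replace (S (2 * n + 5))%nat with (2 * S (n + 2))%nat by lia.
  rewrite mult_INR, ln_mult by (apply lt_0_INR; lia).
  replace (INR 2) with 2 by (simpl; ring). ring.
- replace (2 * ln 2 - 7 / 6) with (2 * (l - l + ln 2) - 7 / 6) by ring.
  apply is_lim_seq_minus'; [| apply is_lim_seq_const].
  apply is_lim_seq_mult'; [apply is_lim_seq_const |].
  apply is_lim_seq_plus'; [| apply is_lim_seq_const].
  apply is_lim_seq_minus'.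
  + apply (is_lim_seq_subseq euler_seq l (fun n => (2 * n + 5)%nat)); [| easy].
    apply eventually_subseq. intros n. lia.
  + apply (is_lim_seq_subseq euler_seq l (fun n => (n + 2)%nat)); [| easy].
    apply eventually_subseq. intros n. lia.
Qed.

(** * The errors of the two approximations: series, tangents at [5/2], monotonicity *)

Definition under_gap (y : R) : R := log_ratio y - log_ratio_approx y.

Definition over_gap (y : R) : R :=
  log_ratio_approx y + / (64 * (y - 1 / 4) ^ 2) - log_ratio y.

Definition under_step (y : R) : R :=
  ln y - ln (y + 1 / 2) - ln (y - 1 / 4) / 2 + ln (y + 3 / 4) / 2.

Definition under_step' (y : R) : R :=
  / y - / (y + 1 / 2) - / (2 * (y - 1 / 4)) + / (2 * (y + 3 / 4)).

Definition over_step (y : R) : R :=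
  / (64 * (y - 1 / 4) ^ 2) - / (64 * (y + 3 / 4) ^ 2) - under_step y.

Definition over_step' (y : R) : R :=
  / (32 * (y + 3 / 4) ^ 3) - / (32 * (y - 1 / 4) ^ 3) - under_step' y.

Lemma under_gap_step (y : R) : 3 / 2 <= y -> under_gap y - under_gap (y + 1) = under_step y.
Proof.
intros Hy. unfold under_gap, under_step, log_ratio_approx.
rewrite (log_ratio_succ y) by lra.
replace (y + 1 - 1 / 4) with (y + 3 / 4) by field. field.
Qed.

Lemma over_gap_step (y : R) : 3 / 2 <= y -> over_gap y - over_gap (y + 1) = over_step y.
Proof.
intros Hy. unfold over_step. rewrite <- under_gap_step by easy.
unfold over_gap, under_gap.
replace (y + 1 - 1 / 4) with (y + 3 / 4) by field. field. lra.
Qed.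

Lemma under_step_derive (y : R) : 3 / 2 <= y -> is_derive under_step y (under_step' y).
Proof.
intros Hy. unfold under_step, under_step'. auto_derive.
- repeat split; lra.
- field. lra.
Qed.

Lemma over_step_derive (y : R) : 3 / 2 <= y -> is_derive over_step y (over_step' y).
Proof.
intros Hy. unfold over_step, over_step'.
apply (is_derive_minus (V := R_NormedModule)); [| now apply under_step_derive].
auto_derive.
- assert (0 < (y - 1 / 4) ^ 2) by (apply pow_lt; lra).
  assert (0 < (y + 3 / 4) ^ 2) by (apply pow_lt; lra).
  simpl in *. repeat split; lra.
- field. lra.
Qed.

Lemma under_gap_lim (y : R) : 3 / 2 <= y -> is_lim_seq (fun n => under_gap (y + INR n)) 0.
Proof. intros Hy. exact (log_ratio_approx_lim y ltac:(lra)). Qed.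

Lemma over_gap_lim (y : R) : 3 / 2 <= y -> is_lim_seq (fun n => over_gap (y + INR n)) 0.
Proof.
intros Hy.
apply is_lim_seq_ext with (fun n => / 64 * (/ (INR n + (y - 1 / 4)) * / (INR n + (y - 1 / 4)))
  - under_gap (y + INR n)).
- intros n. unfold over_gap, under_gap.
  pose proof (pos_INR n). field. lra.
- replace 0 with (/ 64 * (0 * 0) - 0) by ring.
  apply is_lim_seq_minus'; [| now apply under_gap_lim].
  apply is_lim_seq_mult'; [apply is_lim_seq_const |].
  apply is_lim_seq_mult'; apply is_lim_seq_inv_shift.
Qed.

(** Over a common denominator, sign and monotonicity are visible: a negative multiple of the
    reciprocal of an increasing product. *)
Lemma under_step'_eq (y : R) : 3 / 2 <= y ->
  under_step' y = - (3 / 32 * / (y * (y + 1 / 2) * ((y - 1 / 4) * (y + 3 / 4)))).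
Proof. intros Hy. unfold under_step'. field. lra. Qed.

(** The correction [1 / (64 (y - 1/4)^2)] cancels the first-power term of [under_step'_eq]; the
    second and third powers that remain have coefficients of the same sign. *)
Lemma over_step'_eq (y : R) : 3 / 2 <= y ->
  over_step' y = - (25 / 512 * / (y * (y + 1 / 2) * ((y - 1 / 4) * (y + 3 / 4)) ^ 2)
    + 3 / 512 * / (y * (y + 1 / 2) * ((y - 1 / 4) * (y + 3 / 4)) ^ 3)).
Proof. intros Hy. unfold over_step', under_step'. field. lra. Qed.

Lemma step_denominator_mono (k : nat) (u v : R) : 3 / 2 <= u <= v ->
  0 < / (v * (v + 1 / 2) * ((v - 1 / 4) * (v + 3 / 4)) ^ k)
    <= / (u * (u + 1 / 2) * ((u - 1 / 4) * (u + 3 / 4)) ^ k).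
Proof.
intros H.
assert (Hp : forall w, 3 / 2 <= w -> 0 < w * (w + 1 / 2) * ((w - 1 / 4) * (w + 3 / 4)) ^ k).
{ intros w Hw. apply Rmult_lt_0_compat; [| apply pow_lt]; apply Rmult_lt_0_compat; lra. }
split; [apply Rinv_0_lt_compat, Hp; lra |].
apply Rinv_le_contravar; [apply Hp; lra |].
apply Rmult_le_compat.
- apply Rmult_le_pos; lra.
- apply pow_le, Rmult_le_pos; lra.
- apply Rmult_le_compat; lra.
- apply pow_incr. split; [apply Rmult_le_pos; lra |]. apply Rmult_le_compat; lra.
Qed.

Lemma under_step'_mono (u v : R) : 3 / 2 <= u <= v -> under_step' u <= under_step' v.
Proof.
intros H. rewrite !under_step'_eq by lra.
pose proof (step_denominator_mono 1 u v H) as H1. rewrite !pow_1 in H1. lra.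
Qed.

Lemma under_step'_neg (u : R) : 3 / 2 <= u -> under_step' u <= 0.
Proof.
intros H. rewrite under_step'_eq by lra.
pose proof (step_denominator_mono 1 u u ltac:(lra)) as H1. rewrite !pow_1 in H1. lra.
Qed.

Lemma over_step'_mono (u v : R) : 3 / 2 <= u <= v -> over_step' u <= over_step' v.
Proof.
intros H. rewrite !over_step'_eq by lra.
pose proof (step_denominator_mono 2 u v H). pose proof (step_denominator_mono 3 u v H). lra.
Qed.

Lemma over_step'_neg (u : R) : 3 / 2 <= u -> over_step' u <= 0.
Proof.
intros H. rewrite over_step'_eq by lra.
pose proof (step_denominator_mono 2 u u ltac:(lra)).
pose proof (step_denominator_mono 3 u u ltac:(lra)). lra.
Qed.

(** Since [y + 3/4] is [y - 1/4] moved by one, the last two terms of [under_step'] telescope; the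
    ends left over are [2/9 = 1 / (2 * (9/4))] and the one at [n + 13/4]. *)
Lemma under_step'_sum (n : nat) :
  sum_f_R0 (fun k => under_step' (5 / 2 + INR k)) n =
  digamma_half_sum n - 2 / 9 + / 2 * / (INR n + 13 / 4).
Proof.
unfold digamma_half_sum. induction n as [| n IH].
- unfold under_step'. simpl. field.
- rewrite !tech5, IH, S_INR. pose proof (pos_INR n). unfold under_step'. field. lra.
Qed.

(** The cubic terms telescope likewise, with initial end [1 / (32 * (9/4)^3) = 2/729]. *)
Lemma over_step'_sum (n : nat) :
  sum_f_R0 (fun k => over_step' (5 / 2 + INR k)) n =
  / 32 * (/ (INR n + 13 / 4) * (/ (INR n + 13 / 4) * / (INR n + 13 / 4))) - 2 / 729
  - (digamma_half_sum n - 2 / 9 + / 2 * / (INR n + 13 / 4)).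
Proof.
rewrite <- under_step'_sum. induction n as [| n IH].
- unfold over_step', under_step'. simpl. field.
- rewrite !tech5, IH, S_INR. pose proof (pos_INR n). unfold over_step'. field. lra.
Qed.

(** The point [5/2] is the common value of [x + 1/2] and [(x + 3) / 2] at [x = 2]. *)
Lemma under_gap_tangent (y : R) : 3 / 2 <= y ->
  under_gap (5 / 2) + (2 * ln 2 - 7 / 6 - 2 / 9) * (y - 5 / 2) <= under_gap y.
Proof.
intros Hy. apply (telescope_tangent _ under_step under_step' (3 / 2)); try lra.
- exact under_gap_step.
- exact under_step_derive.
- exact under_gap_lim.
- exact under_step'_mono.
- apply is_lim_seq_ext with (1 := fun n => eq_sym (under_step'_sum n)).
  replace (2 * ln 2 - 7 / 6 - 2 / 9) with (2 * ln 2 - 7 / 6 - 2 / 9 + / 2 * 0) by ring.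
  apply is_lim_seq_plus'.
  + apply is_lim_seq_minus'; [apply digamma_half_sum_lim | apply is_lim_seq_const].
  + apply is_lim_seq_mult'; [apply is_lim_seq_const | apply is_lim_seq_inv_shift].
Qed.

Lemma over_gap_tangent (y : R) : 3 / 2 <= y ->
  over_gap (5 / 2) - (2 * ln 2 - 7 / 6 - 2 / 9 + 2 / 729) * (y - 5 / 2) <= over_gap y.
Proof.
intros Hy. unfold Rminus at 1. rewrite Ropp_mult_distr_l.
apply (telescope_tangent _ over_step over_step' (3 / 2)); try lra.
- exact over_gap_step.
- exact over_step_derive.
- exact over_gap_lim.
- exact over_step'_mono.
- apply is_lim_seq_ext with (1 := fun n => eq_sym (over_step'_sum n)).
  replace (- (2 * ln 2 - 7 / 6 - 2 / 9 + 2 / 729)) with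
    (/ 32 * (0 * (0 * 0)) - 2 / 729 - (2 * ln 2 - 7 / 6 - 2 / 9 + / 2 * 0)) by ring.
  pose proof (is_lim_seq_inv_shift (13 / 4)) as H0.
  apply is_lim_seq_minus'.
  + apply is_lim_seq_minus'; [| apply is_lim_seq_const].
    apply is_lim_seq_mult'; [apply is_lim_seq_const |].
    apply is_lim_seq_mult'; [easy |]. now apply is_lim_seq_mult'.
  + apply is_lim_seq_plus'.
    * apply is_lim_seq_minus'; [apply digamma_half_sum_lim | apply is_lim_seq_const].
    * apply is_lim_seq_mult'; [apply is_lim_seq_const | easy].
Qed.

Lemma under_gap_decreasing (y z : R) : 3 / 2 <= y <= z -> under_gap z <= under_gap y.
Proof.
intros H. apply (telescope_decreasing _ under_step under_step' (3 / 2)); try easy.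
- exact under_gap_step.
- exact under_step_derive.
- exact under_gap_lim.
- exact under_step'_neg.
Qed.

Lemma over_gap_decreasing (y z : R) : 3 / 2 <= y <= z -> over_gap z <= over_gap y.
Proof.
intros H. apply (telescope_decreasing _ over_step over_step' (3 / 2)); try easy.
- exact over_gap_step.
- exact over_step_derive.
- exact over_gap_lim.
- exact over_step'_neg.
Qed.

(** * The inequality *)

Lemma ln_Phi (x : R) : 1 < x ->
  ln (Phi x) = ln 2 + (x - 1) * (ln (x - 1) - ln x)
    + log_ratio (x - 1 / 2) - log_ratio ((x + 1) / 2).
Proof.
intros Hx. unfold Phi, log_ratio.
destruct (Req_EM_T x 1) as [E | _]; [lra |].
replace (x - 1 / 2 + 1 / 2) with x by ring.
replace ((x + 1) / 2 + 1 / 2) with (1 + x / 2) by field.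
replace ((x + 1) / 2) with (1 / 2 + x / 2) by field.
pose proof (Gamma_pos x ltac:(lra)). pose proof (Gamma_pos (x - 1 / 2) ltac:(lra)).
pose proof (Gamma_pos (1 + x / 2) ltac:(lra)).
pose proof (Gamma_pos (1 / 2 + x / 2) ltac:(lra)).
assert (0 < Rpower (1 - 1 / x) (x - 1)) by apply exp_pos.
rewrite ln_mult, ln_mult, ln_div, !ln_mult
  by (repeat first [lra | apply Rdiv_lt_0_compat | apply Rmult_lt_0_compat]).
unfold Rpower. rewrite ln_exp.
replace (1 - 1 / x) with ((x - 1) / x) by (field; lra).
rewrite ln_div by lra. ring.
Qed.

(* [Rbound] at [s = x - 2] with [kappa] replaced by the smaller number [5/4],
   in partial fractions. *)
Definition rational_bound (x : R) : R :=
  1 / 30 + / (6 * (4 * x - 3)) - / (3 * (2 * x + 1)).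

(** [kappa > 5/4] because [sqrt 12 < 4], and for [s >= -1] the positive denominator grows with
    [kappa]. *)
Lemma Rbound_le (s : R) : -1 <= s -> Rbound s <= rational_bound (s + 2).
Proof.
intros Hs. unfold Rbound, kappa.
assert (Hk : 5 / 4 < 1 + 1 / sqrt 12).
{ assert (H4 : sqrt 12 < 4).
  { replace 4 with (sqrt (4 * 4)) by (apply sqrt_square; lra). apply sqrt_lt_1; lra. }
  assert (H0 : 0 < sqrt 12) by (apply sqrt_lt_R0; lra).
  apply Rinv_lt_contravar in H4; [unfold Rdiv; lra |].
  apply Rmult_lt_0_compat; lra. }
set (k := 1 + 1 / sqrt 12) in *. clearbody k.
replace (rational_bound (s + 2)) with
  (1 / 24 * (s ^ 2 / (5 / 4 * (5 / 4 + s) * (2 * (5 / 4) + s))))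
  by (unfold rational_bound; field; lra).
apply Rmult_le_compat_l; [lra |].
apply Rmult_le_compat_l; [apply pow2_ge_0 |].
apply Rinv_le_contravar.
- apply Rmult_lt_0_compat; [apply Rmult_lt_0_compat |]; lra.
- apply Rmult_le_compat; [apply Rmult_le_pos | | apply Rmult_le_compat |]; lra.
Qed.

(* The linear term is the sum of the tangent slopes of [under_gap (x + 1/2)] and
   [over_gap ((x + 3) / 2)] at [x = 2], and [1 / 324] is the sum of their values there. *)
Definition lower_gap (x : R) : R :=
  ln 2 + (x - 1) * (ln (x - 1) - ln x)
  + ln (x - 1 / 2) - ln x + ln (x + 1 / 4) / 2
  - ln ((x + 1) / 2) + ln ((x + 2) / 2) - ln ((2 * x + 5) / 4) / 2
  - / (4 * (2 * x + 5) ^ 2) + 1 / 324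
  + (ln 2 - 7 / 12 - 1 / 9 - 1 / 729) * (x - 2)
  - rational_bound x.

Lemma lower_gap_le (x : R) : 1 < x -> lower_gap x <= ln (Phi x) - rational_bound x.
Proof.
intros Hx. rewrite ln_Phi by easy. unfold lower_gap.
(* One recurrence step moves both arguments beyond [3/2], into the range of the tangent bounds. *)
rewrite (log_ratio_succ (x - 1 / 2)), (log_ratio_succ ((x + 1) / 2)) by lra.
pose proof (under_gap_tangent (x + 1 / 2) ltac:(lra)) as Hu.
pose proof (over_gap_tangent ((x + 3) / 2) ltac:(lra)) as Ho.
unfold under_gap, over_gap, log_ratio_approx in Hu, Ho.
replace (x - 1 / 2 + 1 / 2) with x by ring.
replace (x - 1 / 2 + 1) with (x + 1 / 2) by field.
replace ((x + 1) / 2 + 1 / 2) with ((x + 2) / 2) by field.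
replace ((x + 1) / 2 + 1) with ((x + 3) / 2) by field.
replace (x + 1 / 2 - 1 / 4) with (x + 1 / 4) in Hu by field.
replace ((x + 3) / 2 - 1 / 4) with ((2 * x + 5) / 4) in Ho by field.
replace (/ (64 * (5 / 2 - 1 / 4) ^ 2)) with (1 / 324) in Ho by field.
replace (/ (4 * (2 * x + 5) ^ 2)) with (/ (64 * ((2 * x + 5) / 4) ^ 2)) by (field; lra).
lra.
Qed.

Definition lower_gap' (x : R) : R :=
  ln (x - 1) - ln x + / x
  + / (x - 1 / 2) - / x + / (2 * (x + 1 / 4))
  - / (x + 1) + / (x + 2) - / (2 * x + 5) + / (2 * x + 5) ^ 3
  + (ln 2 - 7 / 12 - 1 / 9 - 1 / 729)
  + 2 / (3 * (4 * x - 3) ^ 2) - 2 / (3 * (2 * x + 1) ^ 2).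

Definition lower_gap'' (x : R) : R :=
  / (x ^ 2 * (x - 1)) - 4 / (2 * x - 1) ^ 2 + / x ^ 2 - 8 / (4 * x + 1) ^ 2
  + / (x + 1) ^ 2 - / (x + 2) ^ 2 + 2 / (2 * x + 5) ^ 2 - 6 / (2 * x + 5) ^ 4
  - 16 / (3 * (4 * x - 3) ^ 3) + 8 / (3 * (2 * x + 1) ^ 3).

(** Made for quotients of Horner forms with positive coefficients: [assumption] supplies the
    nonnegativity of the variable. *)
Ltac positivity :=
  match goal with
  | |- 0 < _ * _ => apply Rmult_lt_0_compat; positivity
  | |- 0 < _ / _ => apply Rdiv_lt_0_compat; positivity
  | |- 0 < _ ^ _ => apply pow_lt; positivity
  | |- 0 < _ * _ + _ =>
      apply Rplus_le_lt_0_compat;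
      [apply Rmult_le_pos; [apply Rlt_le; positivity | assumption] | positivity]
  | |- _ => lra
  end.

Lemma lower_gap_derive (x : R) : 1 < x -> is_derive lower_gap x (lower_gap' x).
Proof.
intros Hx. unfold lower_gap, lower_gap', rational_bound. auto_derive.
- repeat split; try lra; simpl; apply Rgt_not_eq;
  repeat (apply Rmult_lt_0_compat; [lra |]); lra.
- replace (x + - (1)) with (x - 1) by ring. field. repeat split; lra.
Qed.

Lemma lower_gap'_derive (x : R) : 1 < x -> is_derive lower_gap' x (lower_gap'' x).
Proof.
intros Hx. unfold lower_gap', lower_gap''. auto_derive.
- repeat split; try lra; simpl; apply Rgt_not_eq;
  repeat (apply Rmult_lt_0_compat; [lra |]); lra.
- replace (x + - (1)) with (x - 1) by ring. field. repeat split; lra.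
Qed.

Lemma lower_gap''_pos (x : R) : 1 < x <= 7 / 3 -> 0 < lower_gap'' x.
Proof.
intros Hx.
(* [v] runs over [0, +oo) as [x] runs over (1, 7/3], and in [v] all coefficients of
   the numerator are positive. *)
set (v := (7 - 3 * x) / (3 * (x - 1))).
assert (Hv : 0 <= v) by (apply Rle_mult_inv_pos; lra).
replace x with ((3 * v + 7) / (3 * v + 3)) by (unfold v; field; lra).
clearbody v. unfold lower_gap''.
replace (_ - _ + _) with (81 / 4 * (1 * v + 1) ^ 4 *
  (((((((((((((((((1883648103030225 * v + 67264225276053384) * v + 1137820394642409108)
    * v + 12015277698001173876) * v + 88113892162989000024) * v + 473762203628923659348)
    * v + 1926585648025659873684) * v + 6035289418888658836164) * v
    + 14709185501982673173138) * v + 27980324352282829256244) * v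
    + 41413939491091323325212) * v + 47215257298139211781212) * v
    + 40674315260787051561552) * v + 25619731706056943731644) * v
    + 11145692520857970340668) * v + 3004092241555950164076) * v + 384633308033252802933)
    * v + 3064368239219840308)
  / ((3 * v + 7) ^ 2 * (3 * v + 11) ^ 2 * (15 * v + 31) ^ 2 * (3 * v + 5) ^ 2 *
     (9 * v + 13) ^ 2 * (21 * v + 29) ^ 4 * (3 * v + 19) ^ 3 * (9 * v + 17) ^ 3))
  by (field; repeat split; lra).
positivity.
Qed.

(** The double zero: the tangents are exact to first order at [x = 2], where [ln (Phi x)] and
    [rational_bound] both vanish to second order. *)
Lemma lower_gap_2 : lower_gap 2 = 0 /\ lower_gap' 2 = 0.
Proof.
split.
- unfold lower_gap, rational_bound.
  replace (2 - 1 / 2) with ((2 + 1) / 2) by field.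
  replace ((2 * 2 + 5) / 4) with (2 + 1 / 4) by field.
  replace ((2 + 2) / 2) with 2 by field.
  replace (2 - 1) with 1 by ring. rewrite ln_1. field.
- unfold lower_gap'. replace (2 - 1) with 1 by ring. rewrite ln_1. field.
Qed.

(** The derivative is strictly increasing and vanishes at 2, so 2 is the strict minimum. *)
Lemma lower_gap_pos (x : R) : 1 < x <= 7 / 3 -> x <> 2 -> 0 < lower_gap x.
Proof.
intros Hx Hx2. destruct lower_gap_2 as [H0 H1].
assert (Hinc : forall u v, 1 < u -> u < v -> v <= 7 / 3 -> lower_gap' u < lower_gap' v).
{ intros u v Hu Huv Hv.
  destruct (MVT_cor2 lower_gap' lower_gap'' u v Huv) as (w & Hw & Hw').
  { intros w Hw. apply is_derive_Reals, lower_gap'_derive. lra. }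
  pose proof (lower_gap''_pos w ltac:(lra)). nra. }
destruct (Rdichotomy _ _ Hx2) as [H | H].
- destruct (MVT_cor2 lower_gap lower_gap' x 2 H) as (w & Hw & Hw').
  { intros w Hw. apply is_derive_Reals, lower_gap_derive. lra. }
  pose proof (Hinc w 2 ltac:(lra) ltac:(lra) ltac:(lra)). nra.
- destruct (MVT_cor2 lower_gap lower_gap' 2 x H) as (w & Hw & Hw').
  { intros w Hw. apply is_derive_Reals, lower_gap_derive. lra. }
  pose proof (Hinc 2 w ltac:(lra) ltac:(lra) ltac:(lra)). nra.
Qed.

(** * The range from [7/3] on, with the roles of the approximations exchanged *)

Definition upper_gap (x : R) : R :=
  ln 2 + (x - 1) * (ln (x - 1) - ln x)
  + ln (x - 1 / 2) - ln x + ln (x + 1 / 4) / 2 + / (64 * (x + 1 / 4) ^ 2)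
  - ln ((x + 1) / 2) + ln ((x + 2) / 2) - ln ((2 * x + 5) / 4) / 2
  - rational_bound x.

(** An identity, not an estimate: the decreasing errors enter with a minus sign, so growth of
    [upper_gap] carries over to the left side. *)
Lemma upper_gap_eq (x : R) : 1 < x ->
  ln (Phi x) - rational_bound x =
  upper_gap x - over_gap (x + 1 / 2) - under_gap ((x + 3) / 2).
Proof.
intros Hx. rewrite ln_Phi by easy.
unfold upper_gap, under_gap, over_gap, log_ratio_approx.
rewrite (log_ratio_succ (x - 1 / 2)), (log_ratio_succ ((x + 1) / 2)) by lra.
replace (x - 1 / 2 + 1 / 2) with x by ring.
replace (x - 1 / 2 + 1) with (x + 1 / 2) by field.
replace ((x + 1) / 2 + 1 / 2) with ((x + 2) / 2) by field.
replace ((x + 1) / 2 + 1) with ((x + 3) / 2) by field.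
replace (x + 1 / 2 - 1 / 4) with (x + 1 / 4) by field.
replace ((x + 3) / 2 - 1 / 4) with ((2 * x + 5) / 4) by field.
ring.
Qed.

Definition upper_gap' (x : R) : R :=
  ln (x - 1) - ln x + / x
  + / (x - 1 / 2) - / x + / (2 * (x + 1 / 4)) - / (32 * (x + 1 / 4) ^ 3)
  - / (x + 1) + / (x + 2) - / (2 * x + 5)
  + 2 / (3 * (4 * x - 3) ^ 2) - 2 / (3 * (2 * x + 1) ^ 2).

Lemma upper_gap_derive (x : R) : 1 < x -> is_derive upper_gap x (upper_gap' x).
Proof.
intros Hx. unfold upper_gap, upper_gap', rational_bound. auto_derive.
- repeat split; try lra; simpl; apply Rgt_not_eq;
  repeat (apply Rmult_lt_0_compat; [lra |]); lra.
- replace (x + - (1)) with (x - 1) by ring. field. repeat split; lra.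
Qed.

(** The left side is [2 artanh w]; on the right, the series after its first term is majorized by a
    geometric one. The difference has a perfect square, up to the factor [4/3], as derivative. *)
Lemma ln_artanh_le (w : R) : 0 < w < 1 ->
  ln (1 + w) - ln (1 - w) <= 2 * w + 2 * w ^ 3 / (3 * (1 - w ^ 2)).
Proof.
intros Hw.
set (f := fun w => 2 * w + 2 * w ^ 3 / (3 * (1 - w ^ 2)) - (ln (1 + w) - ln (1 - w))).
destruct (MVT_cor2 f (fun w => 4 / 3 * (w ^ 2 / (1 - w ^ 2)) ^ 2) 0 w) as (z & Hz & Hz').
- easy.
- intros z Hz. apply is_derive_Reals. unfold f. auto_derive.
  + repeat split; try lra. nra.
  + field. repeat split; try lra; nra.
- assert (H0 : f 0 = 0) by (unfold f; rewrite Rplus_0_r, Rminus_0_r, ln_1; field).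
  assert (0 <= f w - f 0); [rewrite Hz | unfold f in *; lra].
  apply Rmult_le_pos; [| lra]. apply Rmult_le_pos; [lra | apply pow2_ge_0].
Qed.

(** Take [w = 1 / (2 x - 1)], for which [(1 + w) / (1 - w) = x / (x - 1)]. *)
Lemma ln_sub_pred_le (x : R) : 1 < x ->
  ln x - ln (x - 1) <= 2 / (2 * x - 1) + / (6 * x * (x - 1) * (2 * x - 1)).
Proof.
intros Hx.
assert (Hw : 0 < / (2 * x - 1) < 1).
{ split; [apply Rinv_0_lt_compat; lra |].
  rewrite <- Rinv_1. apply Rinv_lt_contravar; lra. }
pose proof (ln_artanh_le _ Hw) as H.
replace (1 + / (2 * x - 1)) with (x / (x - 1 / 2)) in H by (field; lra).
replace (1 - / (2 * x - 1)) with ((x - 1) / (x - 1 / 2)) in H by (field; lra).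
rewrite !ln_div in H by lra.
replace (2 / (2 * x - 1) + / (6 * x * (x - 1) * (2 * x - 1))) with
  (2 * / (2 * x - 1) + 2 * (/ (2 * x - 1)) ^ 3 / (3 * (1 - (/ (2 * x - 1)) ^ 2)));
  [lra |].
field. repeat split; nra.
Qed.

Lemma upper_gap'_pos (x : R) : 7 / 3 <= x -> 0 < upper_gap' x.
Proof.
intros Hx. pose proof (ln_sub_pred_le x ltac:(lra)) as Hln.
apply Rlt_le_trans with
  (- / (6 * x * (x - 1) * (2 * x - 1)) + 2 / (4 * x + 1) - 2 / (4 * x + 1) ^ 3
   - / (x + 1) + / (x + 2) - / (2 * x + 5)
   + 2 / (3 * (4 * x - 3) ^ 2) - 2 / (3 * (2 * x + 1) ^ 2)).
2:{ unfold upper_gap'.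
  replace (/ (x - 1 / 2)) with (2 / (2 * x - 1)) by (field; lra).
  replace (/ (2 * (x + 1 / 4))) with (2 / (4 * x + 1)) by (field; lra).
  replace (/ (32 * (x + 1 / 4) ^ 3)) with (2 / (4 * x + 1) ^ 3) by (field; lra).
  lra. }
(* In [u], which runs over [[0, +oo)], the numerator has positive coefficients only. *)
set (u := 3 * x - 7). assert (Hu : 0 <= u) by (unfold u; lra).
replace x with ((u + 7) / 3) by (unfold u; field).
clearbody u.
replace (_ - _) with (9 / 2 *
  ((((((((((2048 * u + 360704) * u + 16670592) * u + 380059728) * u + 5118199800) * u
    + 43653247668) * u + 240027169614) * u + 831143142582) * u + 1672503592887) * u
    + 1574537359973) * u + 245070395714)
  / ((1 * u + 7) * (1 * u + 4) * (2 * u + 11) * (4 * u + 31) ^ 3 * (1 * u + 10) *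
     (1 * u + 13) * (2 * u + 29) * (4 * u + 19) ^ 2 * (2 * u + 17) ^ 2))
  by (field; repeat split; lra).
positivity.
Qed.

Lemma ln_Phi_gt_rational_bound (x : R) : 1 < x -> x <> 2 -> rational_bound x < ln (Phi x).
Proof.
intros Hx Hx2. destruct (Rle_or_lt x (7 / 3)) as [H | H].
- pose proof (lower_gap_pos x ltac:(lra) Hx2). pose proof (lower_gap_le x Hx). lra.
(* Positivity at [7/3] comes from the first range; from there on the difference increases. *)
- pose proof (lower_gap_pos (7 / 3) ltac:(lra) ltac:(lra)).
  pose proof (lower_gap_le (7 / 3) ltac:(lra)).
  pose proof (upper_gap_eq x Hx). pose proof (upper_gap_eq (7 / 3) ltac:(lra)).
  pose proof (over_gap_decreasing (7 / 3 + 1 / 2) (x + 1 / 2) ltac:(lra)).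
  pose proof (under_gap_decreasing ((7 / 3 + 3) / 2) ((x + 3) / 2) ltac:(lra)).
  destruct (MVT_cor2 upper_gap upper_gap' (7 / 3) x H) as (w & Hw & Hw').
  { intros w Hw. apply is_derive_Reals, upper_gap_derive. lra. }
  pose proof (upper_gap'_pos w ltac:(lra)). nra.
Qed.

(** Otherwise [cos (7/4) >= 0], while the Taylor polynomial of degree 4, an upper bound for [cos],
    is negative at [7/4]. *)
Lemma PI_lt_7_2 : PI < 7 / 2.
Proof.
apply Rnot_le_lt. intros H.
assert (H0 : 0 <= cos (7 / 4)) by (apply cos_ge_0; lra).
destruct (pre_cos_bound (7 / 4) 0) as [_ H1]; [lra | lra |].
unfold cos_approx, cos_term in H1. simpl in H1. lra.
Qed.

(** [ln (4 / PI) >= 1 - PI / 4 > 1/8], whereas [rational_bound 1 = 4/45]. *)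
Lemma ln_Phi_1 : rational_bound 1 < ln (Phi 1).
Proof.
unfold Phi, rational_bound. destruct (Req_EM_T 1 1) as [_ | N]; [| easy].
pose proof PI_lt_7_2. pose proof PI_RGT_0.
pose proof (ln_le_sub_one (PI / 4) ltac:(lra)) as Hln.
rewrite ln_div in * by lra. lra.
Qed.

Lemma Phi_2 : Phi 2 = 1.
Proof.
unfold Phi. destruct (Req_EM_T 2 1) as [E | _]; [lra |].
replace (1 / 2 + 2 / 2) with (3 / 2) by field.
replace (1 + 2 / 2) with 2 by field. replace (2 - 1 / 2) with (3 / 2) by field.
replace (2 - 1) with 1 by ring. rewrite Rpower_1 by lra.
pose proof (Gamma_pos 2 ltac:(lra)). pose proof (Gamma_pos (3 / 2) ltac:(lra)).
field. lra.
Qed.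

Theorem proposition1 :
  (forall s : R, s >= -1 -> s <> 0 -> ln (Phi (s + 2)) > Rbound s) /\
  Phi 2 = 1.
Proof.
split; [| exact Phi_2].
intros s Hs Hs0. apply Rle_lt_trans with (1 := Rbound_le s (Rge_le _ _ Hs)).
destruct (Req_dec s (-1)) as [-> | Hs1].
- replace (-1 + 2) with 1 by ring. exact ln_Phi_1.
- apply ln_Phi_gt_rational_bound; lra.
Qed.
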